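(* Let $n\ge 2$, let $A\in\mathbb{Z}^{m\times n}$ be an integral matrix of full column rank, and suppose there is an integer $k\geq 1$ such that every $n\times n$ minor of $A$ lies in $\{0,\pm k,\pm 2k\}$. Then: (1) For every $b\in\mathbb{Z}^m$, $c\in\mathbb{Q}^n$ and every optimal vertex $x^*$ of $\max\{c^\top x: Ax\le b,\ x\in\mathbb{R}^n\}$, if the integer program $\max\{c^\top x : Ax\le b,\ x\in\mathbb{Z}^n\}$ is feasible, then it has an optimal solution $z^*$ with \[ \|x^*-z^*\|_\infty\le\max\{\Delta_{n-1}(A),\Delta_n(A)\}-1\quad\text{and}\quad \|x^*-z^*\|_\infty<\Delta_{n-1}(A). \] (2) For every $b\in\mathbb{Z}^m$ such that $P=\{x\in\mathbb{R}^n:Ax\le b\}$ is full-dimensional, satisfies $P\cap\mathbb{Z}^n=\emptyset$, and each row of $A$ defines a facet of $P$, there exists a row $a^\top$ of $A$ with \[ w^{a}(P)\le \Delta_n(A)-2. \]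
   Context: For $j\in\{1,\dots,n\}$, $\Delta_j(A)$ denotes the maximum of $|\det M|$ over all $j\times j$ submatrices $M$ of $A$. For $a\in\mathbb{R}^n\setminus\{0\}$, $w^{a}(P)=\max_{x\in P}a^\top x-\min_{y\in P}a^\top y$. *)

(* Defs.v *)
From HB Require Import structures.
From mathcomp Require Import all_boot all_order all_algebra.
From mathcomp Require Import boolp classical_sets reals constructive_ereal ereal.

Set Implicit Arguments.
Unset Strict Implicit.
Unset Printing Implicit Defensive.

Import Order.TTheory GRing.Theory Num.Theory.
Local Open Scope ring_scope.

Definition Delta (m n j : nat) (A : 'M[int]_(m, n)) : nat :=
  \max_(f : {ffun 'I_j -> 'I_m} | injectiveb f)
    \max_(g : {ffun 'I_j -> 'I_n} | injectiveb g)
      absz (\det (mxsub f g A)).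

Definition mxR (R : realType) (m n : nat) (A : 'M[int]_(m, n)) : 'M[R]_(m, n) :=
  map_mx (fun z : int => z%:~R) A.

Definition inP (R : realType) (m n : nat) (A : 'M[int]_(m, n)) (b : 'cV[int]_m)
  (x : 'cV[R]_n) : Prop :=
  forall i : 'I_m, (mxR R A *m x) i 0 <= (b i 0)%:~R.

Definition inPZ (m n : nat) (A : 'M[int]_(m, n)) (b : 'cV[int]_m)
  (z : 'cV[int]_n) : Prop :=
  forall i : 'I_m, (A *m z) i 0 <= b i 0.

Definition intvec (R : realType) (n : nat) (z : 'cV[int]_n) : 'cV[R]_n :=
  map_mx (fun t : int => t%:~R) z.

Definition is_vertex (R : realType) (n : nat) (S : 'cV[R]_n -> Prop)
  (x : 'cV[R]_n) : Prop :=
  S x /\ forall (y z : 'cV[R]_n) (t : R), S y -> S z -> 0 < t < 1 ->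
    x = t *: y + (1 - t) *: z -> y = z.

(* the affine hull of S has dimension at least d: S contains d+1 affinely
   independent points *)
Definition affdim_ge (R : realType) (n : nat) (S : 'cV[R]_n -> Prop) (d : nat)
  : Prop :=
  exists pts : 'I_d.+1 -> 'cV[R]_n,
    (forall i, S (pts i)) /\
    \rank (\matrix_(i < d, j < n) (pts (lift ord0 i) j 0 - pts ord0 j 0)) = d.

Definition affdim_eq (R : realType) (n : nat) (S : 'cV[R]_n -> Prop) (d : nat)
  : Prop := affdim_ge S d /\ ~ affdim_ge S d.+1.

Definition full_dim (R : realType) (n : nat) (S : 'cV[R]_n -> Prop) : Prop :=
  affdim_ge S n.

Definition row_facet (R : realType) (m n : nat) (A : 'M[int]_(m, n))
  (b : 'cV[int]_m) (i : 'I_m) : Prop :=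
  exists d : nat,
    affdim_eq (@inP R _ _ A b) d.+1 /\
    affdim_eq (fun x => @inP R _ _ A b x /\ (mxR R A *m x) i 0 = (b i 0)%:~R) d.

Definition norm_inf (R : realType) (n : nat) (v : 'cV[R]_n) : R :=
  \big[Num.max/0]_(i < n) `|v i 0|.

(* w^a(P) = max_{x in P} a^T x - min_{y in P} a^T y, as an extended real
   (sup / inf, which are attained when finite for a polyhedron) *)
Definition width (R : realType) (n : nat) (S : 'cV[R]_n -> Prop)
  (a : 'rV[R]_n) : \bar R :=
  (ereal_sup [set ((a *m x) 0 0)%:E | x in S] -
   ereal_inf [set ((a *m x) 0 0)%:E | x in S])%E.

Definition cdot (R : realType) (n : nat) (c : 'cV[rat]_n) (x : 'cV[R]_n) : R :=
  \sum_(j < n) ratr (c j 0) * x j 0.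

(* Main.v *)
Require Import Defs.
From HB Require Import structures.
From mathcomp Require Import all_boot all_order all_algebra.
From mathcomp Require Import boolp classical_sets reals constructive_ereal ereal.
From mathcomp Require Import zify ring lra.
Import Order.TTheory GRing.Theory Num.Theory.
Set Implicit Arguments.
Unset Strict Implicit.
Unset Printing Implicit Defensive.
Local Open Scope ring_scope.

(* Let g be the least nonzero absolute value of an n x n minor, so that all of
   them lie in {0, g, 2g}, and let L be the lattice of vectors on which every row
   of A is integral; Z^n has index g in L.
   Among the optimal integer points choose z closest to the vertex v, flip signs
   of rows so that p = v - z satisfies A p >= 0, and decompose p.  If p is not in
   L, the rows integral on p form, in a basis of tight rows, a totally unimodular
   system; peeling its extreme rays off p leaves one ray rho with p - rho in L and
   with the values +-1/2 on the remaining rows, whence still A (p - rho) >= 0.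
   A vector of L in the cone A y >= 0 is in turn a sum of vectors of L in the cone,
   each being an extreme ray, half of one, or half a sum of two.
   With g pieces or more, some consecutive pieces would sum to an integer vector
   (pigeonhole in L / Z^n) and z could be moved closer to v.  So there are at
   most g - 1 pieces, and Cramer's rule bounds every linear form on each of them.
   For flatness, relax right-hand sides one at a time until an integer point
   appears; proximity for the last relaxed row a_i, as an objective, bounds
   a_i (z - v) by Delta_n - 1, and z violates a_i x <= b_i by at least 1. *)

(** * Row replacement and maximal minors *)

Definition setrow (T : Type) (m n : nat) (M : 'M[T]_(m, n)) (j : 'I_m)
    (u : 'rV[T]_n) : 'M[T]_(m, n) :=
  \matrix_(i, l) if i == j then u 0 l else M i l.

Definition upd (T : Type) (n : nat) (h : 'I_n -> T) (j : 'I_n) (t : T) :=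
  fun l => if l == j then t else h l.

Lemma mulmx_adj_setrow (K : comPzRingType) (n : nat) (M : 'M[K]_n) (u : 'rV[K]_n) j :
  (u *m \adj M) 0 j = \det (setrow M j u).
Proof.
rewrite (expand_det_row _ j) mxE; apply: eq_bigr => l _.
rewrite !mxE eqxx; congr (_ * (_ * \det _)).
by apply/matrixP=> x y; rewrite !mxE eq_sym (negbTE (neq_lift _ _)).
Qed.

Lemma absz_det_row_scale (n : nat) (d : 'rV[int]_n) (M : 'M[int]_n) :
  (forall i, absz (d 0 i) = 1%N) -> absz (\det (diag_mx d *m M)) = absz (\det M).
Proof.
move=> d1; rewrite det_mulmx abszM det_diag.
suff -> : absz (\prod_i d 0 i) = 1%N by rewrite mul1n.
by elim/big_ind: _ => // x y hx hy; rewrite abszM hx hy.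
Qed.

Section Minors.
Variables (m n : nat) (A : 'M[int]_(m, n)).

Definition rowdet (h : 'I_n -> 'I_m) : int := \det (rowsub h A).

Definition substdet (h : 'I_n -> 'I_m) j (u : 'rV[int]_n) : int :=
  \det (setrow (rowsub h A) j u).

Lemma substdet_row h j i : substdet h j (row i A) = rowdet (upd h j i).
Proof.
congr (\det _); apply/matrixP=> x y; rewrite !mxE /upd.
by case: (x == j).
Qed.

Lemma rowdet_inj h : rowdet h != 0 -> injective h.
Proof.
move=> h0 x y hxy; apply/eqP/negPn/negP => nxy; move/negP: h0; apply.
apply/eqP/(determinant_alternate nxy) => l.
by rewrite !mxE hxy.
Qed.

End Minors.

(** * Cramer's rule, bases of rows and extreme rays *)

Section RealRows.
Variables (R : realType) (m n : nat) (A : 'M[int]_(m, n)).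
Implicit Types (y u : 'cV[R]_n) (h : 'I_n -> 'I_m).

Definition lin (a : 'rV[int]_n) y : R := (map_mx intr a *m y) 0 0.
Definition rowval i y : R := (mxR R A *m y) i 0.

Lemma rowvalE i y : rowval i y = lin (row i A) y.
Proof. by rewrite /rowval /lin !mxE; apply: eq_bigr => j _; rewrite !mxE. Qed.

Lemma linD a : {morph lin a : x y / x + y}.
Proof. by move=> x y; rewrite /lin mulmxDr mxE. Qed.
Lemma linZ a c y : lin a (c *: y) = c * lin a y.
Proof. by rewrite /lin -scalemxAr mxE. Qed.
Lemma linN a y : lin a (- y) = - lin a y.
Proof. by rewrite /lin mulmxN mxE. Qed.
Lemma lin0 a : lin a 0 = 0.
Proof. by rewrite /lin mulmx0 mxE. Qed.

Lemma rowvalD i : {morph rowval i : x y / x + y}.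
Proof. by move=> x y; rewrite !rowvalE linD. Qed.
Lemma rowvalZ i c y : rowval i (c *: y) = c * rowval i y.
Proof. by rewrite !rowvalE linZ. Qed.
Lemma rowvalN i y : rowval i (- y) = - rowval i y.
Proof. by rewrite !rowvalE linN. Qed.
Lemma rowvalB i : {morph rowval i : x y / x - y}.
Proof. by move=> x y; rewrite rowvalD rowvalN. Qed.
Lemma rowval0 i : rowval i 0 = 0.
Proof. by rewrite rowvalE lin0. Qed.

Lemma lin_delta j y : lin (delta_mx 0 j) y = y j 0.
Proof.
rewrite /lin map_delta_mx -rowE mxE //.
Qed.

(** Evaluate at [y] the identity that [a] times the adjugate of [M] times [M] is det M times [a]. *)
Lemma cramer h a y :
  (rowdet A h)%:~R * lin a y = \sum_j (substdet A h j a)%:~R * rowval (h j) y.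
Proof.
set M := rowsub h A.
have e : (rowdet A h) *: a = (a *m \adj M) *m M.
  by rewrite -mulmxA mul_adj_mx scalar_mxC mul_scalar_mx.
rewrite /lin.
have -> : (rowdet A h)%:~R * (map_mx intr a *m y) 0 0
  = (map_mx intr (rowdet A h *: a) *m y) 0 0 :> R.
  by rewrite map_mxZ -scalemxAl [in RHS]mxE.
rewrite e map_mxM -mulmxA mxE; apply: eq_bigr => j _.
rewrite [in X in X * _ = _]mxE mulmx_adj_setrow /substdet; congr (_ * _).
by rewrite /rowval !mxE; apply: eq_bigr => l _; rewrite !mxE.
Qed.

Lemma cramer_row h i y :
  (rowdet A h)%:~R * rowval i y
  = \sum_j (rowdet A (upd h j i))%:~R * rowval (h j) y.
Proof.
by rewrite rowvalE cramer; apply: eq_bigr => j _; rewrite substdet_row.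
Qed.

Lemma cramer_ray h j0 y a : (forall j, j != j0 -> rowval (h j) y = 0) ->
  (rowdet A h)%:~R * lin a y = (substdet A h j0 a)%:~R * rowval (h j0) y.
Proof.
move=> z; rewrite cramer (bigD1 j0) //= big1 ?addr0 // => j /z ->.
by rewrite mulr0.
Qed.

Lemma cramer_ray_row h j0 y i : (forall j, j != j0 -> rowval (h j) y = 0) ->
  (rowdet A h)%:~R * rowval i y = (rowdet A (upd h j0 i))%:~R * rowval (h j0) y.
Proof. by move=> z; rewrite rowvalE (cramer_ray _ z) substdet_row. Qed.

Lemma lin_inj y : (forall j, lin (delta_mx 0 j) y = 0) -> y = 0.
Proof.
by move=> z; apply/matrixP=> i j; rewrite ord1 [RHS]mxE -lin_delta.
Qed.

Lemma basis_eq0 h y : rowdet A h != 0 -> (forall j, rowval (h j) y = 0) -> y = 0.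
Proof.
move=> h0 z; apply: lin_inj => j; apply/eqP.
have := cramer h (delta_mx 0 j) y.
rewrite big1 => [/eqP|l _]; last by rewrite z mulr0.
by rewrite mulf_eq0 intr_eq0 (negbTE h0).
Qed.

Lemma basis_exists (S : pred 'I_m) :
  (forall d, (forall i, S i -> rowval i d = 0) -> d = 0) ->
  exists h, (forall j, S (h j)) /\ rowdet A h != 0.
Proof.
move=> H.
(* Rows outside [S] become zero rows, which no nonsingular choice of rows can contain. *)
pose X : 'M[R]_(m, n) := \matrix_(i, j) if S i then (A i j)%:~R else 0.
have rX : row_full X.
  rewrite -cokermx_eq0; apply/eqP/matrixP => i j; rewrite [RHS]mxE.
  suff /matrixP/(_ i 0) : col j (cokermx X) = 0 by rewrite !mxE.
  apply: H => l Sl; have /matrixP/(_ l j) := mulmx_coker X.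
  rewrite [RHS]mxE => <-; rewrite /rowval !mxE; apply: eq_bigr => x _.
  by rewrite !mxE Sl.
have U := fullrowsub_unit rX; set h := fullrankfun rX in U.
have Sh j : S (h j).
  apply/negPn/negP => nS; move: U; rewrite unitmxE (expand_det_row _ j) big1 ?unitr0 //.
  by move=> l _; rewrite !mxE (negbTE nS) mul0r.
exists h; split=> //; move: U; rewrite unitmxE unitfE.
suff -> : rowsub h X = map_mx intr (rowsub h A) by rewrite det_map_mx intr_eq0.
by apply/matrixP=> x y; rewrite !mxE Sh.
Qed.

Lemma basis_kernel h d : rowdet A h != 0 -> forall S : pred 'I_m,
  (forall j, S (h j)) -> (forall i, S i -> rowval i d = 0) -> d = 0.
Proof. by move=> h0 S Sh z; apply: (basis_eq0 h0) => j; apply: z. Qed.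

(* Push [u] along a direction killed by its vanishing rows and by [i0] until a
   new row vanishes. *)
Lemma ray_exists (S : pred 'I_m) u i0 :
    (forall d, (forall i, S i -> rowval i d = 0) -> d = 0) ->
    (forall i, S i -> 0 <= rowval i u) -> S i0 -> 0 < rowval i0 u ->
  exists h j0 y, [/\ (forall j, S (h j)), h j0 = i0, rowdet A h != 0,
    (forall j, j != j0 -> rowval (h j) y = 0) &
    [/\ 0 < rowval i0 y, (forall i, S i -> 0 <= rowval i y) &
        forall i, S i -> rowval i u = 0 -> rowval i y = 0]].
Proof.
move=> kS; move: {2}_.+1 (ltnSn #|[pred i | S i && (rowval i u != 0)]|) => N.
elim: N u => // N IH u leN u0 Si0 ui0.
(* A nonzero direction killed by [Z] keeps the zeros of [u] and its value at [i0]; if there is none,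
   [Z] contains a basis and [u] itself spans the ray. *)
pose Z := [pred i | S i && ((rowval i u == 0) || (i == i0))].
have [[d0 [d0n d0Z]]|nd] := pselect (exists d, d <> 0 /\ forall i, Z i -> rowval i d = 0).
  have [i1 Si1 d0i1] : exists2 i, S i & rowval i d0 != 0.
    have /existsNP[i /not_implyP[Si /eqP i0n]] : ~ forall i, S i -> rowval i d0 = 0.
      by move=> /kS.
    by exists i.
  have [d [di1 dZ]] : exists d, rowval i1 d < 0 /\ forall i, Z i -> rowval i d = 0.
    move: d0i1; rewrite neq_lt => /orP[?|?]; first by exists d0.
    exists (- d0); rewrite rowvalN oppr_lt0; split=> // i /d0Z.
    by rewrite rowvalN => ->; rewrite oppr0.
  pose P := [pred i | S i && (rowval i d < 0)].
  have Pi1 : P i1 by rewrite /= Si1.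
  case: (arg_minP (fun i => rowval i u / - rowval i d) Pi1) => i2 /andP[Si2 di2] mi2.
  (* Ratio test: the largest step that keeps the rows of [S] nonnegative; row [i2] vanishes after
     it. *)
  set t := rowval i2 u / - rowval i2 d in mi2.
  have t0 : 0 <= t by rewrite divr_ge0 ?u0 // oppr_ge0 ltW.
  have vE i : rowval i (u + t *: d) = rowval i u + t * rowval i d.
    by rewrite rowvalD rowvalZ.
  have ui0' : rowval i0 (u + t *: d) = rowval i0 u.
    by rewrite vE dZ ?mulr0 ?addr0 //= Si0 eqxx orbT.
  have [||//||h [j0 [y [hS hj hn hz [yi0 y0 yu]]]]] := IH (u + t *: d).
  - rewrite ltnS in leN; apply: leq_trans leN; apply: proper_card; apply/properP; split.
      apply/fintype.subsetP => i; rewrite !inE => /andP[Si]; rewrite Si vE /=.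
      by apply: contraNneq => z; rewrite z dZ ?mulr0 ?addr0 //= Si z eqxx.
    exists i2; rewrite !inE Si2 /=.
      apply/eqP => z; have : rowval i2 d = 0 by apply: dZ; rewrite /= Si2 z eqxx.
      by move=> e; rewrite e ltxx in di2.
    by rewrite negbK vE /t; apply/eqP; field; rewrite lt_eqF.
  - move=> i Si; rewrite vE.
    have [di|di] := leP 0 (rowval i d); first by apply: addr_ge0; [exact: u0 | exact: mulr_ge0].
    have := mi2 i; rewrite /= Si di => /(_ isT).
    by rewrite ler_pdivlMr ?oppr_gt0 // mulrN lerNl -subr_ge0 opprK addrC.
  - by rewrite ui0'.
  exists h, j0, y; split=> //; split=> // i Si iu; apply: yu => //.
  by rewrite vE iu dZ ?mulr0 ?addr0 //= Si iu eqxx.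
have [d dZ|h [hZ hn]] := @basis_exists Z.
  by apply: contra_notP nd => dn; exists d.
have hS j : S (h j) by case/andP: (hZ j).
have [j0 hj0] : exists j0, h j0 = i0.
  apply: contrapT => nj; suff : u = 0 by move=> e; move: ui0; rewrite e rowval0 ltxx.
  apply: (basis_eq0 hn) => j; case/andP: (hZ j) => _ /orP[/eqP//|/eqP e].
  by case: nj; exists j.
exists h, j0, u; split=> // j jj0; case/andP: (hZ j) => _ /orP[/eqP//|/eqP e].
by case/eqP: jj0; apply: (rowdet_inj hn); rewrite e.
Qed.

End RealRows.

(** * Integers and half-integers among the reals *)

Section IntegralReals.
Variable R : realType.
Implicit Types x y : R.

Lemma int_gt0_ge1 x : x \is a Num.int -> 0 < x -> 1 <= x.
Proof. by move=> /intrP[z ->]; rewrite ltr0z ler1z gtz0_ge1. Qed.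

Lemma half_int_sub x y : 2 * x \is a Num.int -> 2 * y \is a Num.int ->
  x \isn't a Num.int -> y \isn't a Num.int -> x - y \is a Num.int.
Proof.
have half (t : R) (a : int) : 2 * t = a%:~R -> t \isn't a Num.int ->
    exists b : int, t = b%:~R + 2^-1.
  move=> ta nt; exists (a %/ 2)%Z.
  have e := divz_eq a 2; have r0 : (a %% 2)%Z = 0 \/ (a %% 2)%Z = 1 by lia.
  have tE : t = (a %/ 2)%Z%:~R + (a %% 2)%Z%:~R / 2.
    have : a%:~R = (a %/ 2)%Z%:~R * 2 + (a %% 2)%Z%:~R :> R.
      by rewrite {1}e intrD intrM.
    by rewrite -ta; lra.
  case: r0 tE => ->; last by rewrite mul1r.
  by rewrite mul0r addr0 => tE; rewrite tE rpred_int in nt.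
move=> /intrP[a /half xa] /intrP[b /half yb] /xa[c ->] /yb[d ->].
by rewrite opprD addrACA subrr addr0 rpredB // rpred_int.
Qed.

Lemma half_int_ge x : 2 * x \is a Num.int -> x \isn't a Num.int -> 0 <= x -> 2^-1 <= x.
Proof.
move=> x2 nx x0; have [x00|xn0] := eqVneq x 0; first by rewrite x00 rpred0 in nx.
have : 0 < 2 * x by rewrite mulr_gt0 // lt_def xn0.
by move=> /(int_gt0_ge1 x2); lra.
Qed.

End IntegralReals.

(** * Bounds on linear forms in terms of minors *)

Section Cost.
Variables (R : realType) (m n : nat) (A : 'M[int]_(m, n)).
Implicit Types (y u : 'cV[R]_n) (h : 'I_n -> 'I_m).

(* With [a] a unit vector, [M] bounds the minors of order [n - 1]; with [a] a row
   of [A], it bounds those of order [n]. *)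
Definition cost y (c : R) := forall a (M : nat),
  (forall h j, (absz (substdet A h j a) <= M)%N) -> `|lin a y| <= M%:R * c.

Lemma cost0 : cost 0 0.
Proof. by move=> a M _; rewrite lin0 normr0 mulr0. Qed.

Lemma costD y u c d : cost y c -> cost u d -> cost (y + u) (c + d).
Proof.
move=> yc ud a M H; rewrite linD mulrDr.
by apply: le_trans (ler_normD _ _) _; apply: lerD; [exact: yc|exact: ud].
Qed.

Lemma cost_le y c d : c <= d -> cost y c -> cost y d.
Proof.
by move=> cd yc a M H; apply: le_trans (yc a M H) _; rewrite ler_wpM2l.
Qed.

(** On a ray Cramer's rule has a single term; the determinant of [h] cancels against the
    normalisation of [y] at row [h j0]. *)
Lemma cost_ray h j0 y c : rowdet A h != 0 ->
  (forall j, j != j0 -> rowval A (h j) y = 0) ->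
  `|rowval A (h j0) y| = c * (absz (rowdet A h))%:R -> cost y c.
Proof.
move=> hn hz e a M /(_ h j0) H.
have D0 : 0 < (absz (rowdet A h))%:R :> R by rewrite ltr0n absz_gt0.
have c0 : 0 <= c by rewrite -(pmulr_lge0 _ D0) -e.
have := congr1 (fun x => `|x|) (cramer_ray a hz).
rewrite /= !normrM e -!intr_norm -!abszE => E.
rewrite -(ler_pM2l D0) E [X in _ <= X]mulrC -mulrA.
by rewrite ler_wpM2r ?mulr_ge0 ?ler_nat // ltW.
Qed.

End Cost.

(** * The lattice L and its detection by bases *)

Section Bimodular.
Variables (R : realType) (m n : nat) (A : 'M[int]_(m, n)) (g : nat).
Hypothesis g0 : (0 < g)%N.
Hypothesis Adet : forall h, absz (rowdet A h) \in [:: 0; g; 2 * g]%N.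
Implicit Types (y u p w : 'cV[R]_n) (h : 'I_n -> 'I_m).
Local Notation val := (rowval A).

(** The lattice L; by [basis_dual_int] the rows of any basis of determinant [g] up to sign already
    cut it out. *)
Definition dual_int y := forall i, val i y \is a Num.int.

Lemma dual_intB u y : dual_int u -> dual_int y -> dual_int (u - y).
Proof. by move=> hu hy i; rewrite rowvalB rpredB. Qed.

Lemma basis_rowval_int h i y (c : int) : rowdet A h != 0 ->
  (forall j, (rowdet A h %| c * rowdet A (upd h j i))%Z) ->
  (forall j, val (h j) y \is a Num.int) -> c%:~R * val i y \is a Num.int.
Proof.
move=> hn dv hy; have hn' : (rowdet A h)%:~R != 0 :> R by rewrite intr_eq0.
have E : (rowdet A h)%:~R * (c%:~R * val i y) =
  (rowdet A h)%:~R * \sum_j ((c * rowdet A (upd h j i)) %/ rowdet A h)%Z%:~R * val (h j) y.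
  rewrite mulrCA cramer_row !mulr_sumr; apply: eq_bigr => j _.
  by rewrite !mulrA -!intrM mulrC [_ * (_ %/ _)%Z]mulrC divzK // mulrC.
by rewrite (mulfI hn' E); apply: rpred_sum => j _; apply: rpredM => //; apply: rpred_int.
Qed.

(** All minors are multiples of [g], so every Cramer coefficient in the basis [h] is an integer. *)
Lemma basis_dual_int h y : absz (rowdet A h) = g ->
  (forall j, val (h j) y \is a Num.int) -> dual_int y.
Proof.
move=> hg hy i; rewrite -[val i y]mul1r -[1]/(1%:~R); apply: basis_rowval_int hy.
  by rewrite -absz_gt0 hg.
move=> j; rewrite mul1r dvdzE hg; have := Adet (upd h j i); rewrite !inE.
by case/or3P=> /eqP ->; rewrite ?dvdn0 ?dvdnn ?dvdn_mull.
Qed.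

(** A nonzero minor is [g] or [2 * g] up to sign, hence divides twice any minor. *)
Lemma basis_dual_half_int h y i : rowdet A h != 0 ->
  (forall j, val (h j) y \is a Num.int) -> 2 * val i y \is a Num.int.
Proof.
move=> hn; apply: (basis_rowval_int (c := 2)) => // j.
rewrite dvdzE abszM; have := Adet (upd h j i); have := Adet h; rewrite !inE.
rewrite absz_eq0 (negbTE hn) /=.
by case/orP=> /eqP -> /or3P[] /eqP ->;
  do ?[exact: dvdn0 | exact: dvdnn | apply: dvdn_mull].
Qed.

Lemma non_dual_int_basis h y : rowdet A h != 0 ->
  (forall j, val (h j) y \is a Num.int) -> ~ dual_int y ->
  absz (rowdet A h) = (2 * g)%N.
Proof.
move=> hn hy ny; have := Adet h; rewrite !inE absz_eq0 (negbTE hn) /=.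
by case/orP=> /eqP // /basis_dual_int/(_ hy).
Qed.

(** * The odd part of a vector outside L *)

Section OddPart.
Variables (p : 'cV[R]_n) (h0 : 'I_n -> 'I_m).
Hypothesis p0 : forall i, 0 <= val i p.
Hypothesis h0n : rowdet A h0 != 0.
Hypothesis h0p : forall j, val (h0 j) p \is a Num.int.
Hypothesis pn : ~ dual_int p.
Let S : pred 'I_m := [pred i | val i p \is a Num.int].

(* Exchanging a suitable row of [h0] for a row non-integral on [p] yields a basis
   of determinant [g], so a vector integral on [h0] has only one fractional class. *)
Lemma dual_int_dichotomy y : (forall i, S i -> val i y \is a Num.int) ->
  dual_int y \/ dual_int (p - y).
Proof.
move=> yS.
have [i1 /negP i1n] : exists i, ~ (val i p \is a Num.int) by apply/existsNP.
(* Otherwise every exchanged minor would be a multiple of [2 * g], the determinant of [h0] up to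
   sign, and row [i1] would be integral on [p]. *)
have [j1 j1g] : exists j, absz (rowdet A (upd h0 j i1)) = g.
  apply: contrapT => /forallNP nj; move/negP: i1n; apply.
  rewrite -[val i1 p]mul1r -[1]/(1%:~R); apply: basis_rowval_int h0p => // j.
  rewrite mul1r dvdzE (non_dual_int_basis h0n h0p pn).
  have := Adet (upd h0 j i1); rewrite !inE.
  by case/or3P=> /eqP e; rewrite ?e ?dvdn0 ?dvdnn //; case: (nj j).
have key (u : 'cV[R]_n) : (forall i, S i -> val i u \is a Num.int) -> val i1 u \is a Num.int -> dual_int u.
  move=> uS ui1; apply: (basis_dual_int j1g) => j; rewrite /upd.
  by case: ifP => // _; apply/uS/h0p.
have [yi1|yi1] := boolP (val i1 y \is a Num.int); first by left; apply: key.
right; apply: key => [i Si|]; first by rewrite rowvalB rpredB // yS.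
rewrite rowvalB; apply: half_int_sub => //; apply: (basis_dual_half_int _ h0n) => //.
by move=> j; apply/yS/h0p.
Qed.

(** Bases inside [S] have determinant [2 * g] up to sign, so a normalised extreme ray takes only the
    values 0 and 1 on [S]. Rays in L are peeled off; as [p] is not in L, a ray congruent to [p] must
    turn up, and Cramer's rule restricts it off [S]. *)
Lemma odd_part : exists r : 'cV[R]_n, [/\ dual_int (p - r),
  (forall i, val i p \is a Num.int -> 0 <= val i r <= val i p),
  (forall i, val i p \isn't a Num.int -> `|val i r| <= 2^-1) &
  cost A r (2 * g)%:R^-1].
Proof.
have kS (d : 'cV[R]_n) : (forall i, S i -> val i d = 0) -> d = 0.
  by apply: (basis_kernel h0n).
have D2 h : (forall j, S (h j)) -> absz (rowdet A h) \in [:: 0; 2 * g]%N.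
  move=> hS; have [->|hn] := eqVneq (rowdet A h) 0; first by rewrite !inE.
  by rewrite (non_dual_int_basis hn hS pn) !inE eqxx orbT.
(* [q] is [p] minus the rays peeled off so far; each of them lowers the sum over [S] by at least
   1. *)
suff IH (N : nat) (q : 'cV[R]_n) : dual_int (p - q) ->
    (forall i, S i -> 0 <= val i q <= val i p) -> \sum_(i | S i) val i q < N%:R ->
    exists r : 'cV[R]_n, [/\ dual_int (p - r),
      (forall i, val i p \is a Num.int -> 0 <= val i r <= val i p),
      (forall i, val i p \isn't a Num.int -> `|val i r| <= 2^-1) &
      cost A r (2 * g)%:R^-1].
  have s0 : 0 <= \sum_(i | S i) val i p by apply: sumr_ge0 => i _.
  apply: (IH _ p _ _ (archi_boundP s0)) => [i|i _]; first by rewrite subrr rowval0 rpred0.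
  by rewrite p0 lexx.
elim: N q => [|N IH] q pq qS qN.
  by move: qN; rewrite ltNge sumr_ge0 // => i /qS/andP[].
have qi i : S i -> val i q \is a Num.int.
  by move=> Si; rewrite -[q](subKr p) rowvalB rpredB.
have [i0 [Si0 qi0]] : exists i0, S i0 /\ 0 < val i0 q.
  apply: contrapT => /forallNP nq; apply: pn; suff q0 : q = 0 by rewrite -[p]subr0 -q0.
  apply: kS => i Si; apply/eqP; rewrite eq_le; case/andP: (qS i Si) => -> _.
  by rewrite andbT leNgt; apply/negP => ?; apply: (nq i).
have [|h [j0 [y [hS hj hn hz [yi0 y0 yu]]]]] := ray_exists kS _ Si0 qi0.
  by move=> i /qS /andP[].
set r := (val i0 y)^-1 *: y.
have rE i : val i r = (val i0 y)^-1 * val i y by rewrite rowvalZ.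
have ri0 : val i0 r = 1 by rewrite rE mulVf // gt_eqF.
have rz j : j != j0 -> val (h j) r = 0 by move=> jj; rewrite rE hz ?mulr0.
have hg : absz (rowdet A h) = (2 * g)%N by have := D2 h hS; rewrite !inE absz_eq0 (negbTE hn) => /eqP.
have g2 : 0 < (2 * g)%:R :> R by rewrite ltr0n muln_gt0.
have rabs i : `|val i r| = (absz (rowdet A (upd h j0 i)))%:R / (2 * g)%:R.
  have := congr1 (fun x => `|x|) (cramer_ray_row i rz).
  rewrite /= !normrM hj ri0 normr1 mulr1 -!intr_norm -!abszE -!pmulrn hg => <-.
  by rewrite mulrC mulKf // gt_eqF.
have rS i : S i -> val i r = 0 \/ val i r = 1.
  move=> Si; have r0 : 0 <= val i r by rewrite rE mulr_ge0 ?y0 // invr_ge0 ltW.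
  have := rabs i; rewrite ger0_norm // => ->.
  have /D2 : forall j, S (upd h j0 i j) by move=> j; rewrite /upd; case: ifP => // _; apply: hS.
  by rewrite !inE => /orP[] /eqP ->; [left; rewrite mul0r|right; rewrite divff ?gt_eqF].
have rq i : S i -> 0 <= val i r <= val i q.
  move=> Si; case: (rS i Si) => e; rewrite e; first by rewrite lexx; case/andP: (qS i Si).
  rewrite ler01 int_gt0_ge1 ?qi //; case/andP: (qS i Si) => q0i _.
  rewrite lt_def q0i andbT; apply/negP => /eqP /(yu i Si) e'.
  by move/eqP: e; rewrite rE e' mulr0 eq_sym oner_eq0.
have rint i : S i -> val i r \is a Num.int by move=> /rS[] ->; rewrite ?rpred0 ?rpred1.
(* Either [r] lies in L and is peeled off, or [p - r] does and [r] is the ray sought. *)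
have [re|ro] := dual_int_dichotomy rint.
  apply: (IH (q - r)).
  - by move=> i; rewrite opprB addrCA rowvalD rpredD.
  - move=> i Si; case/andP: (rq i Si); case/andP: (qS i Si); rewrite rowvalB.
    by move=> ????; apply/andP; split; lra.
  - rewrite (eq_bigr _ (fun i _ => rowvalB _ i _ _)) sumrB.
    suff : 1 <= \sum_(i | S i) val i r by move: qN; rewrite -natr1; lra.
    rewrite (bigD1 i0) //= ri0 lerDl sumr_ge0 // => i /andP[/rq/andP[]//].
exists r; split=> // [i Si|i ni|].
- case/andP: (rq i Si) => -> /le_trans -> //; by case/andP: (qS i Si).
- have nr : val i r \isn't a Num.int.
    by apply: contra ni => ri; rewrite -[p](subrK r) rowvalD rpredD.
  have := rabs i; have := Adet (upd h j0 i); rewrite !inE.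
  case/or3P=> /eqP -> e.
  + by rewrite e mul0r.
  + by rewrite e natrM invfM mulrCA divff ?mulr1 // pnatr_eq0 -lt0n.
  + move: e; rewrite divff ?(gt_eqF g2) // => /eqP; rewrite eqr_norml => /andP[/orP[]/eqP e _];
      by rewrite e ?rpredN rpred1 in nr.
- by apply: (cost_ray hn rz); rewrite hj ri0 normr1 hg mulVf // gt_eqF.
Qed.

End OddPart.
End Bimodular.

(** * Decomposition of lattice vectors in the cone *)

Section Decomposition.
Variables (R : realType) (m n : nat) (A : 'M[int]_(m, n)) (g : nat).
Hypothesis g0 : (0 < g)%N.
Hypothesis Adet : forall h, absz (rowdet A h) \in [:: 0; g; 2 * g]%N.
Variable hb : 'I_n -> 'I_m.
Hypothesis hbn : rowdet A hb != 0.
Implicit Types (y u p w : 'cV[R]_n) (h : 'I_n -> 'I_m).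
Local Notation val := (rowval A).

Lemma rowval_eq0 w : (forall i, val i w = 0) -> w = 0.
Proof. by move=> w0; apply: (basis_eq0 hbn) => j. Qed.

Lemma exists_rowval_gt0 w : (forall i, 0 <= val i w) -> w <> 0 ->
  exists i, 0 < val i w.
Proof.
move=> w0 wn; apply: contrapT => /forallNP H; apply: wn; apply: rowval_eq0 => i.
by apply/eqP; rewrite eq_le w0 andbT leNgt; apply/negP/H.
Qed.

Lemma dual_int_sum_ge1 w : dual_int A w -> (forall i, 0 <= val i w) -> w <> 0 ->
  1 <= \sum_i val i w.
Proof.
move=> wi w0 /(exists_rowval_gt0 w0)[i wi0]; rewrite (bigD1 i) //=.
apply: le_trans (int_gt0_ge1 (wi i) wi0) _; rewrite lerDl.
by apply: sumr_ge0.
Qed.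

(* An extreme ray [r] below [w], scaled to take values in {0, 1, 2}, gives a piece
   of [w] directly unless it takes the value 2 and [r / 2] is not dual integral;
   in that case [w - r / 2] has an odd part. *)
Lemma dual_int_split w : dual_int A w -> (forall i, 0 <= val i w) -> w <> 0 ->
  cost A w g%:R^-1 \/
  exists w', [/\ dual_int A w', w' <> 0, w' <> w & forall i, 0 <= val i w' <= val i w].
Proof.
move=> wi w0 wn; have [i0 wi0] := exists_rowval_gt0 w0 wn.
have [||//||h [j0 [y [_ hj hn hz [yi0 y0 yu]]]]] := @ray_exists R m n A predT w i0.
- by move=> d H; apply: rowval_eq0 => i; apply: H.
- by move=> i _; apply: w0.
- by [].
have gR : 0 < g%:R :> R by rewrite ltr0n.
have D0 : 0 < (absz (rowdet A h))%:R :> R by rewrite ltr0n absz_gt0.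
(* With this scale the value of [r] at each row is the size of a minor divided by [g]. *)
set c := (absz (rowdet A h))%:R / g%:R / val i0 y.
have c0 : 0 < c by rewrite !divr_gt0.
set r := c *: y.
have rE i : val i r = c * val i y by rewrite rowvalZ.
have ri0 : val i0 r = (absz (rowdet A h))%:R / g%:R.
  by rewrite rE /c divfK // gt_eqF.
have rz j : j != j0 -> val (h j) r = 0 by move=> jj; rewrite rE hz ?mulr0.
have r0 i : 0 <= val i r by rewrite rE mulr_ge0 ?y0 // ltW.
have rw i : val i w = 0 -> val i r = 0 by move=> /yu e; rewrite rE e ?mulr0.
have rabs i : val i r = (absz (rowdet A (upd h j0 i)))%:R / g%:R.
  have := congr1 (fun x => `|x|) (cramer_ray_row i rz).
  rewrite /= !normrM hj ri0 -!intr_norm -!abszE -!pmulrn ger0_norm // ger0_norm ?divr_ge0 ?ler0n //.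
  by rewrite mulrCA => /(mulfI (lt0r_neq0 D0)).
have r012 i : [\/ val i r = 0, val i r = 1 | val i r = 2].
  rewrite rabs; have := Adet (upd h j0 i); rewrite !inE => /or3P[] /eqP ->.
  - by constructor 1; rewrite mul0r.
  - by constructor 2; rewrite divff ?gt_eqF.
  - by constructor 3; rewrite natrM mulfK ?gt_eqF.
have rn : r <> 0 by move=> e; move: ri0; rewrite e rowval0 => /eqP; rewrite eq_sym gt_eqF // divr_gt0.
have w1 i : 0 < val i r -> 1 <= val i w.
  move=> ri; apply: int_gt0_ge1 => //; rewrite lt_def w0 andbT; apply/eqP => /rw e.
  by rewrite e ltxx in ri.
have costr t : 0 <= t -> cost A (t *: r) (t / g%:R).
  move=> t0; apply: (cost_ray (h := h) (j0 := j0) hn) => [j /rz e|]; first by rewrite rowvalZ e mulr0.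
  rewrite rowvalZ hj ri0 ger0_norm ?mulr_ge0 ?invr_ge0 ?ler0n //.
  by rewrite -mulrA [g%:R^-1 * _]mulrC.
have half i : val i (2^-1 *: r) <= val i w.
  by rewrite rowvalZ; case: (r012 i) (w1 i) (w0 i) => ->; lra.
have [[i1 ri1]|/forallNP n2] := pselect (exists i, val i r = 2); last first.
  have rle i : 0 <= val i r <= val i w.
    rewrite r0; case: (r012 i) => [->|e|/n2//]; first exact: w0.
    by rewrite e; apply: w1; rewrite e.
  have [e|ne] := pselect (r = w); last first.
    right; exists r; split=> // i; case: (r012 i) => ->; by rewrite ?rpred0 ?rpred1 ?rpred_nat.
  by left; have := costr 1 ler01; rewrite scale1r e mul1r.
have [rg|rng] := pselect (dual_int A (2^-1 *: r)).
  have rhn : 2^-1 *: r <> 0.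
    by move=> /eqP; rewrite scaler_eq0 invr_eq0 pnatr_eq0 /= => /eqP.
  have [e|ne] := pselect (2^-1 *: r = w).
    left; rewrite -e; apply: cost_le (costr _ _); rewrite ?invr_ge0 ?ler0n //.
    by rewrite ler_piMl ?invr_ge0 ?ler0n // invf_le1 // ler1n.
  by right; exists (2^-1 *: r); split=> // i; rewrite half rowvalZ mulr_ge0 ?invr_ge0.
set q := w - 2^-1 *: r.
have qE i : val i q = val i w - 2^-1 * val i r by rewrite rowvalB rowvalZ.
have q0 i : 0 <= val i q by rewrite rowvalB subr_ge0.
have nq : ~ dual_int A q.
  move=> qg; apply: rng; have -> : 2^-1 *: r = w - q by rewrite opprB addrC subrK.
  exact: dual_intB.
(* Exchanging [h j0] for [i1] gives a basis on which [q] is integral: half of [r] is 0 on the kept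
   rows and 1 on [i1]. *)
have hn' : rowdet A (upd h j0 i1) != 0.
  rewrite -absz_eq0; apply/eqP => e; move: (rabs i1); rewrite e mul0r ri1 => /eqP.
  by rewrite pnatr_eq0.
have hq j : val (upd h j0 i1 j) q \is a Num.int.
  rewrite qE rpredB //; rewrite /upd; case: eqP => [_|/eqP/rz ->]; last by rewrite mulr0 rpred0.
  by rewrite ri1 mulVf ?pnatr_eq0 ?rpred1.
have [rho [qr rS rN rc]] := odd_part g0 Adet q0 hn' hq nq.
(* Where [q] is not integral, [r] is 1, so [q] is at least 1/2 and at most [w] minus 1/2;
   subtracting [rho] moves it by at most 1/2. *)
have le_w' i : 0 <= val i (q - rho) <= val i w.
  rewrite [val i (q - rho)]rowvalB.
  have [qi|qi] := boolP (val i q \is a Num.int).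
    by have := rS i qi; have := r0 i; have := qE i; move=> ?? /andP[??]; apply/andP; split; lra.
  have := rN i qi; rewrite ler_norml => /andP[? ?].
  have := half_int_ge (basis_dual_half_int Adet i hn' hq) qi (q0 i) => ?.
  have e : val i r = 1.
    by case: (r012 i) => // e; move: qi; rewrite qE e ?mulr0 ?mulVf ?pnatr_eq0 // rpredB ?rpred0 ?rpred1.
  by have := qE i; rewrite e => ?; apply/andP; split; lra.
(* If equality holds, [w] is half of [r] plus [rho], and each summand contributes half of the cost
   1/g. *)
have [e|ne] := pselect (q - rho = 0).
  left; have -> : w = 2^-1 *: r + rho.
    by rewrite -(subr0_eq e) /q addrC subrK.
  have -> : g%:R^-1 = 2^-1 / g%:R + (2 * g)%:R^-1 :> R.
    by rewrite natrM invfM -mulrDl; field; rewrite gt_eqF.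
  by apply: costD => //; apply: costr; rewrite invr_ge0.
(* [q - rho] is not [w]: at [i1] it is smaller by at least 1. *)
right; exists (q - rho); split=> // e.
have qi1 : val i1 q = val i1 w - 1 by rewrite qE ri1 mulVf ?pnatr_eq0.
have := rS i1; rewrite qi1 rpredB ?rpred1 // => /(_ isT)/andP[? _].
by have := congr1 (val i1) e; rewrite rowvalB qi1; lra.
Qed.

(** Repeated splitting ends: a nonzero lattice vector of the cone has row values summing to at least
    1, so both parts of a split have a sum smaller by at least 1. *)
Lemma dual_int_decomp w : dual_int A w -> (forall i, 0 <= val i w) ->
  exists2 ws : seq 'cV[R]_n,
    (forall x, x \in ws -> [/\ dual_int A x, forall i, 0 <= val i x, x <> 0 & cost A x g%:R^-1]) &
    \sum_(x <- ws) x = w.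
Proof.
move=> wi w0.
have s0 : 0 <= \sum_i val i w by apply: sumr_ge0.
move: (archi_boundP s0); move: (Num.bound _) => N wN {s0}.
elim: N w wi w0 wN => [|N IH] w wi w0 wN.
  by move: wN; rewrite ltNge sumr_ge0.
have [w00|wn] := pselect (w = 0); first by exists [::]; rewrite ?big_nil.
have [c|[w' [wi' wn' wnw le']]] := dual_int_split wi w0 wn.
  exists [:: w]; last by rewrite big_seq1.
  by move=> x; rewrite inE => /eqP ->; split.
have w'0 i : 0 <= val i w' by case/andP: (le' i).
have d0 i : 0 <= val i (w - w') by rewrite rowvalB subr_ge0; case/andP: (le' i).
have dn : w - w' <> 0 by move=> /subr0_eq e; apply: wnw.
have di := dual_intB wi wi'.
have sE : \sum_i val i w = \sum_i val i w' + \sum_i val i (w - w').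
  by rewrite -big_split; apply: eq_bigr => i _; rewrite /= rowvalB addrC subrK.
have s1 := dual_int_sum_ge1 wi' w'0 wn'; have s2 := dual_int_sum_ge1 di d0 dn.
move: wN; rewrite sE -natr1 => wN.
have [|ws1 p1 e1] := IH w' wi' w'0; first lra.
have [|ws2 p2 e2] := IH (w - w') di d0; first lra.
exists (ws1 ++ ws2); last by rewrite big_cat /= e1 e2 addrC subrK.
by move=> x; rewrite mem_cat => /orP[/p1|/p2].
Qed.

End Decomposition.

(** * Pigeonhole modulo the integer vectors *)

Lemma card_ord_lt (N d : nat) : (d <= N)%N -> #|[pred t : 'I_N | (t < d)%N]| = d.
Proof.
move=> dN; rewrite -sum1_card -(big_ord_widen N (fun=> 1%N)) //.
by rewrite sum1_card card_ord.
Qed.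

Lemma eq_abs_modz (d x y : int) : d != 0 ->
  absz (x %% d)%Z = absz (y %% d)%Z -> (d %| x - y)%Z.
Proof.
move=> d0 e; rewrite -eqz_mod_dvd; apply/eqP.
by rewrite -[LHS](gez0_abs (modz_ge0 x d0)) -[RHS](gez0_abs (modz_ge0 y d0)) e.
Qed.

(* By the Smith normal form, B Z^n has index |det B| in Z^n. *)
Lemma lattice_pigeonhole (n : nat) (B : 'M[int]_n) (X : nat -> 'cV[int]_n) :
  \det B != 0 ->
  exists i j (z : 'cV[int]_n), (i < j <= absz (\det B))%N /\ X j - X i = B *m z.
Proof.
move=> B0; have [L Lu [U Uu [d _ Bd]]] := int_Smith_normal_form B.
set D := \matrix_(i, j) _ in Bd; pose e (i : 'I_n) : int := d`_i.
have DE : D = diag_mx (\row_i (e i)).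
  by apply/matrixP => i j; rewrite !mxE.
have det1 (M : 'M[int]_n) : M \in unitmx -> absz (\det M) = 1%N.
  by rewrite unitmxE qualifE /= => /orP[] /eqP ->.
have detB : absz (\det B) = (\prod_(i < n) absz (e i))%N.
  rewrite Bd !det_mulmx !abszM det1 // (det1 U) // mul1n muln1 DE det_diag.
  by elim/big_rec2: _ => // i x y _ <-; rewrite mxE abszM.
have d0 (i : 'I_n) : (e i) != 0.
  apply: contra B0 => /eqP ei; rewrite -absz_eq0 detB (bigD1 i) //= ei.
  by rewrite absz0 mul0n.
have dle (i : 'I_n) : (absz (e i) <= (absz (\det B)).+1)%N.
  apply: leqW; apply: dvdn_leq; first by rewrite absz_gt0.
  by rewrite detB (bigD1 i) //= dvdn_mulr.
pose x l := invmx L *m X l; pose xc l i : int := x l i 0.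
(* The class of [X l] modulo the lattice spanned by the columns of [B], read off from residues
   modulo the elementary divisors. Residues never exceed |det B|, so the default of [inord] does not
   arise. *)
pose phi (l : 'I_(absz (\det B)).+1) : {ffun 'I_n -> 'I_(absz (\det B)).+1} :=
  [ffun i => inord (absz (xc l i %% (e i))%Z)].
have mlt l i : (absz (xc l i %% (e i))%Z < absz (e i))%N.
  by rewrite -ltz_nat gez0_abs ?modz_ge0 // abszE ltz_mod.
pose F (i : 'I_n) : pred 'I_(absz (\det B)).+1 := [pred t : 'I_(absz (\det B)).+1 | (t < absz (e i))%N].
(* There are |det B| + 1 indices, but only |det B| residue vectors, the product of the |e i|. *)
have /injectivePn[l1 [l2 nl el]] : ~~ injectiveb phi.
  apply/negP => /injectiveP /card_codom; rewrite card_ord => cc.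
  have : (#|codom phi| <= #|(family F : simpl_pred {ffun 'I_n -> 'I_(absz (\det B)).+1})|)%N.
    apply: subset_leq_card; apply/fintype.subsetP => f /codomP[l ->].
    apply/familyP => i; rewrite !inE ffunE inordK //; apply: leq_trans (mlt l i) _.
    exact: dle.
  rewrite cc card_family.
  suff -> : foldr muln 1%N [seq #|F x| | x : 'I_n] = (\prod_(i < n) absz (e i))%N by rewrite -detB ltnn.
  rewrite /image_mem foldrE big_map enumT; apply: eq_bigr => i _.
  by rewrite card_ord_lt.
have key (a b : nat) :
    (forall i, absz (xc a i %% (e i))%Z = absz (xc b i %% (e i))%Z) ->
    exists z, X b - X a = B *m z.
  move=> ab; exists (invmx U *m \col_i ((xc b i - xc a i) %/ (e i))%Z).
  have -> : X b - X a = L *m (x b - x a) by rewrite -mulmxBr mulKVmx.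
  rewrite Bd -!mulmxA mulKVmx //; congr (_ *m _).
  rewrite DE; apply/matrixP => i j; rewrite ord1 mul_diag_mx !mxE mulrC divzK //.
    by rewrite /xc /x !mxE.
  by apply: eq_abs_modz; rewrite ?ab.
have phiE (a b : 'I_(absz (\det B)).+1) i :
    phi a = phi b -> absz (xc a i %% (e i))%Z = absz (xc b i %% (e i))%Z.
  move=> /ffunP/(_ i); rewrite !ffunE => /(congr1 val).
  by rewrite /= !inordK // (leq_trans (mlt _ _)).
case: (ltngtP l1 l2) nl => [lt|lt|/val_inj ->]; last by rewrite eqxx.
- have [z ez] := key _ _ (fun i => phiE _ _ i el); exists l1, l2, z; rewrite lt; split=> //.
  by rewrite -ltnS ltn_ord.
- have [z ez] := key _ _ (fun i => phiE _ _ i (esym el)); exists l2, l1, z; rewrite lt; split=> //.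
  by rewrite -ltnS ltn_ord.
Qed.

Lemma rowval_intvec (R : realType) (m n : nat) (A : 'M[int]_(m, n)) i z :
  rowval A i (intvec R z) = ((A *m z) i 0)%:~R.
Proof. by rewrite /rowval /mxR /intvec -map_mxM mxE. Qed.

Lemma lin_intvec (R : realType) (n : nat) (a : 'rV[int]_n) z :
  lin a (intvec R z) = ((a *m z) 0 0)%:~R.
Proof. by rewrite /lin /intvec -map_mxM mxE. Qed.

(* The partial sums of [ws] cannot be pairwise distinct modulo Z^n, which has
   index |rowdet A h| in the lattice of vectors integral on the rows [h]. *)
Lemma integral_block (R : realType) (m n : nat) (A : 'M[int]_(m, n)) h
    (ws : seq 'cV[R]_n) :
  rowdet A h != 0 -> (forall w, w \in ws -> dual_int A w) ->
  (absz (rowdet A h) <= size ws)%N ->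
  exists vs1 vs vs2 z, [/\ ws = vs1 ++ vs ++ vs2, vs <> [::] & \sum_(w <- vs) w = intvec R z].
Proof.
move=> hn wi sz; pose s l := \sum_(w <- take l ws) w.
have si l : dual_int A (s l).
  rewrite /s big_seq => i; elim/big_rec: _ => [|w x /mem_take/wi wg xg].
    by rewrite rowval0 rpred0.
  by rewrite rowvalD rpredD.
(* The floors are exact, since partial sums are integral on every row. *)
pose X l : 'cV[int]_n := \col_t Num.floor (rowval A (h t) (s l)).
have [i [j [z [/andP[ij jg] e]]]] := lattice_pigeonhole X hn.
have jsz : (j <= size ws)%N := leq_trans jg sz.
exists (take i ws), (take (j - i) (drop i ws)), (drop j ws), z.
have tj : take j ws = take i ws ++ take (j - i) (drop i ws).
  by rewrite -takeD subnKC // ltnW.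
split.
- by rewrite catA -tj cat_take_drop.
- move=> /(congr1 size); rewrite size_take size_drop /=; case: ifP; lia.
have -> : \sum_(w <- take (j - i) (drop i ws)) w = s j - s i.
  by rewrite /s tj big_cat /= [X in _ = X - _]addrC addrK.
apply/eqP; rewrite -subr_eq0; apply/eqP; apply: (basis_eq0 hn) => t.
rewrite !rowvalB rowval_intvec -(floorK (si j (h t))) -(floorK (si i (h t))).
rewrite -!intrB; have := congr1 (fun M : 'cV_n => M t 0) e; rewrite !mxE => ->.
rewrite -[X in _ = X]/(0%:~R); congr (_%:~R); rewrite [X in _ - X](_ : _ = (rowsub h A *m z) t 0).
  by rewrite mxE subrr.
by rewrite !mxE; apply: eq_bigr => x _; rewrite !mxE.
Qed.

Lemma cost_sum (R : realType) (m n : nat) (A : 'M[int]_(m, n)) (c : R)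
    (ws : seq 'cV[R]_n) :
  (forall w, w \in ws -> cost A w c) -> cost A (\sum_(w <- ws) w) ((size ws)%:R * c).
Proof.
elim: ws => [|w ws IH] H; first by rewrite big_nil mul0r; apply: cost0.
rewrite big_cons /= -natr1 mulrDl mul1r addrC; apply: costD; last first.
  by apply: H; rewrite inE eqxx.
by apply: IH => x xw; apply: H; rewrite inE xw orbT.
Qed.

(** * Cost of vectors that dominate no nonzero integer vector *)

Section Proximity.
Variables (R : realType) (m n : nat) (g D : nat).
Hypothesis g0 : (0 < g)%N.
Implicit Types (A : 'M[int]_(m, n)) (h : 'I_n -> 'I_m) (p : 'cV[R]_n).

(** Fewer than [g] pieces of cost 1/g give the bound at once. With [g] or more, a nonempty block of
    pieces sums to an integer vector below [w]; it would have to be 0, yet its first piece is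
    positive on some row. *)
Lemma dual_int_cost A h1 (u : 'I_m -> R) (w : 'cV[R]_n) :
  (forall h, absz (rowdet A h) \in [:: 0; g; 2 * g]%N) ->
  absz (rowdet A h1) = g -> dual_int A w ->
  (forall i, 0 <= rowval A i w < u i) ->
  (forall y : 'cV[int]_n, (forall i, 0 <= rowval A i (intvec R y) < u i) -> y = 0) ->
  cost A w (1 - g%:R^-1).
Proof.
move=> Adet h1g wi wu noy.
have h1n : rowdet A h1 != 0 by rewrite -absz_gt0 h1g.
have [|ws wsP wsE] := dual_int_decomp g0 Adet h1n wi.
  by move=> i; case/andP: (wu i).
have gR : 0 < g%:R :> R by rewrite ltr0n.
have [szg|szg] := leqP g (size ws); last first.
  rewrite -wsE; apply: cost_le (cost_sum (c := g%:R^-1) _); last by move=> x /wsP[].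
  rewrite lerBrDr -[X in _ + X]mul1r -mulrDl ler_pdivrMr // mul1r natr1.
  by rewrite ler_nat.
have [||vs1 [vs [vs2 [z [wsv vsn vsz]]]]] := @integral_block R m n A h1 ws h1n.
- by move=> x /wsP[].
- by rewrite h1g.
have sum0 (s : seq 'cV[R]_n) i : {subset s <= ws} -> 0 <= rowval A i (\sum_(x <- s) x).
  move=> sw; rewrite big_seq; elim/big_rec: _ => [|x y xs y0]; first by rewrite rowval0.
  by rewrite rowvalD addr_ge0 //; case/sw/wsP: xs.
have s1 : {subset vs1 <= ws} by move=> x xv; rewrite wsv mem_cat xv.
have sv : {subset vs <= ws} by move=> x xv; rewrite wsv !mem_cat xv orbT.
have s2 : {subset vs2 <= ws} by move=> x xv; rewrite wsv !mem_cat xv !orbT.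
have z0 : z = 0.
  apply: noy => i; rewrite -vsz sum0 //=; case/andP: (wu i) => _; apply: le_lt_trans.
  rewrite -wsE wsv !big_cat /= !rowvalD.
  by have := sum0 _ i s1; have := sum0 _ i s2; lra.
case: vs vsn vsz sv {wsv} => // v vs _ vsz sv.
have [vi v0 vn _] := wsP v (sv v (mem_head _ _)).
have [i vi0] := exists_rowval_gt0 h1n v0 vn.
have := congr1 (rowval A i) vsz.
rewrite big_cons rowvalD z0 rowval_intvec mulmx0 mxE => e.
have : 0 <= rowval A i (\sum_(x <- vs) x).
  by apply: sum0 => x xv; apply: sv; rewrite inE xv orbT.
by move: e; lra.
Qed.

(** Outside L, [p - r] costs at most 1 - 1/g and the odd part [r] at most half of 1/g. The total
    fits because a basis integral on [p] then has determinant [2 * g] up to sign, whence [2 * g] is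
    at most [D]. *)
Lemma proximity_nonneg A h1 h0 p :
  (forall h, absz (rowdet A h) \in [:: 0; g; 2 * g]%N) ->
  (forall h, (absz (rowdet A h) <= D)%N) ->
  absz (rowdet A h1) = g -> rowdet A h0 != 0 ->
  (forall j, rowval A (h0 j) p \is a Num.int) ->
  (forall i, 0 <= rowval A i p) ->
  (forall y : 'cV[int]_n,
     (forall i, 0 <= rowval A i (intvec R y) < rowval A i p + 1) -> y = 0) ->
  cost A p (1 - D%:R^-1).
Proof.
move=> Adet AD h1g h0n h0p p0 noy.
have gR : 0 < g%:R :> R by rewrite ltr0n.
have [pg|png] := pselect (dual_int A p).
  apply: cost_le (dual_int_cost Adet h1g pg _ noy).
    have gD : (g <= D)%N by rewrite -h1g.
    by rewrite lerD2l lerN2 lef_pV2 ?posrE ?ltr0n ?ler_nat // (leq_trans g0).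
  by move=> i; rewrite p0 ltrDl ltr01.
have [r [pr rS rN rc]] := odd_part g0 Adet p0 h0n h0p png.
(* On rows not integral on [p], [p - r] may exceed [p] by 1/2, which the margin 1 absorbs. *)
have le_w i : 0 <= rowval A i (p - r) < rowval A i p + 1.
  rewrite [rowval A i (p - r)]rowvalB; have [pi|pi] := boolP (rowval A i p \is a Num.int).
    by case/andP: (rS i pi) => ??; apply/andP; split; lra.
  have := rN i pi; rewrite ler_norml => /andP[??].
  have := half_int_ge (basis_dual_half_int Adet i h0n h0p) pi (p0 i) => ?.
  by apply/andP; split; lra.
have := costD (dual_int_cost Adet h1g pr le_w noy) rc; rewrite subrK; apply: cost_le.
have gD : (2 * g <= D)%N by rewrite -(non_dual_int_basis g0 Adet h0n h0p png).
have -> : 1 - g%:R^-1 + (2 * g)%:R^-1 = 1 - (2 * g)%:R^-1 :> R.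
  by rewrite natrM; field; rewrite gt_eqF.
rewrite lerD2l lerN2 lef_pV2 ?posrE ?ltr0n ?ler_nat ?muln_gt0 //.
by apply: leq_trans gD; rewrite muln_gt0.
Qed.

(** Flipping the rows negative on [p] preserves minors up to sign and reduces to the nonnegative
    case. On those rows only the sign of [y] is constrained, since lowering a row never violates an
    upper bound. *)
Lemma proximity_conformal A h1 h0 p :
  (forall h, absz (rowdet A h) \in [:: 0; g; 2 * g]%N) ->
  (forall h, (absz (rowdet A h) <= D)%N) ->
  absz (rowdet A h1) = g -> rowdet A h0 != 0 ->
  (forall j, rowval A (h0 j) p \is a Num.int) ->
  (forall y : 'cV[int]_n,
     (forall i, if 0 <= rowval A i p then 0 <= rowval A i (intvec R y) < rowval A i p + 1
                else rowval A i (intvec R y) <= 0) -> y = 0) ->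
  cost A p (1 - D%:R^-1).
Proof.
move=> Adet AD h1g h0n h0p noy.
pose s i : int := if 0 <= rowval A i p then 1 else -1.
have s1 i : absz (s i) = 1%N by rewrite /s; case: ifP.
pose A' : 'M[int]_(m, n) := \matrix_(i, j) (s i * A i j).
have detA' h : absz (rowdet A' h) = absz (rowdet A h).
  rewrite /rowdet -(@absz_det_row_scale _ (\row_j s (h j)) (rowsub h A)) => [|j]; last by rewrite mxE.
  by congr (absz (\det _)); apply/matrixP => i j; rewrite mul_diag_mx !mxE.
have sdetA' h j a : absz (substdet A' h j a) = absz (substdet A h j a).
  rewrite /substdet -(@absz_det_row_scale _ (\row_l if l == j then 1 else s (h l))
    (setrow (rowsub h A) j a)).
    congr (absz (\det _)); apply/matrixP => x y; rewrite mul_diag_mx !mxE.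
    by case: ifP; rewrite ?mul1r.
  by move=> l; rewrite mxE; case: ifP.
have valA' i (y : 'cV[R]_n) : rowval A' i y = (s i)%:~R * rowval A i y.
  rewrite /rowval !mxE mulr_sumr; apply: eq_bigr => j _.
  by rewrite !mxE intrM mulrA.
suff c' : cost A' p (1 - D%:R^-1).
  by move=> a M aM; apply: c' => h j; rewrite sdetA'.
apply: (proximity_nonneg (h1 := h1) (h0 := h0)) => [h|h|||j|i|y yi].
- by rewrite detA'.
- by rewrite detA'.
- by rewrite detA'.
- by rewrite -absz_eq0 detA' absz_eq0.
- by rewrite valA' rpredM ?rpred_int.
- by rewrite valA' /s; case: ifPn; rewrite ?mul1r // -ltNge mulN1r oppr_ge0 => /ltW.
apply: noy => i; have := yi i; rewrite !valA' /s; case: ifPn => _; rewrite ?mul1r //.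
by rewrite !mulN1r oppr_ge0 => /andP[].
Qed.

End Proximity.

(** * Proximity of integral optima *)

Lemma exists_min_nat (T : Type) (P : T -> Prop) (f : T -> nat) : (exists x, P x) ->
  exists2 x, P x & forall y, P y -> (f x <= f y)%N.
Proof.
move=> [x0 Px0]; have E : exists k, `[< exists2 x, P x & f x = k >].
  by exists (f x0); apply/asboolP; exists x0.
case: (ex_minnP E) => k /asboolP[x Px fx] kmin; exists x => // y Py.
by rewrite fx; apply: kmin; apply/asboolP; exists y.
Qed.

Lemma exists_pos_lower_bound (R : realType) (m : nat) (f : 'I_m -> R) :
  (forall i, 0 < f i) -> exists2 e, 0 < e & forall i, e <= f i.
Proof.
move=> f0; have s0 : 0 <= \sum_i (f i)^-1 by apply: sumr_ge0 => i _; rewrite invr_ge0 ltW.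
exists (1 + \sum_i (f i)^-1)^-1; first by rewrite invr_gt0 ltr_wpDr.
move=> i; rewrite -[f i]invrK lef_pV2 ?posrE ?invr_gt0 // ?ltr_wpDr //.
rewrite (bigD1 i) //= addrCA lerDl addr_ge0 //; apply: sumr_ge0 => j _.
by rewrite invr_ge0 ltW.
Qed.

Lemma inP_step (R : realType) (m n : nat) (A : 'M[int]_(m, n)) b (x d : 'cV[R]_n) :
  inP A b x ->
  (forall i, rowval A i x = (b i 0)%:~R -> rowval A i d <= 0) ->
  exists2 e, 0 < e & inP A b (x + e *: d).
Proof.
move=> xP dt.
(* The value 1 on tight rows is arbitrary; the 1 in the denominator avoids division by zero. *)
pose f i := if rowval A i x == (b i 0)%:~R then 1
            else ((b i 0)%:~R - rowval A i x) / (1 + `|rowval A i d|).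
have d1 i : 0 < 1 + `|rowval A i d| by rewrite ltr_wpDr.
have [|e e0 ef] := @exists_pos_lower_bound R m f.
  move=> i; rewrite /f; case: eqP => // /eqP ne; rewrite divr_gt0 // subr_gt0.
  by rewrite lt_def eq_sym ne; apply: xP.
exists e => // i; rewrite -/(rowval A i _) rowvalD rowvalZ.
have := ef i; rewrite /f; case: eqP => [t _|_].
  rewrite t gerDl; apply: mulr_ge0_le0; [exact: ltW | exact: dt].
rewrite ler_pdivlMr // => H.
have : e * rowval A i d <= e * (1 + `|rowval A i d|).
  apply: ler_wpM2l; first exact: ltW.
  by apply: le_trans (ler_norm _) _; rewrite lerDr.
by move: H; lra.
Qed.

(** Closeness to [xs] is measured by the total slack on the basis rows [h0], an integer. Adding to
    the closest optimum [z] a vector [y] as in [proximity_conformal] keeps it feasible and optimal,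
    so minimality forces [y = 0]. *)
Lemma integer_proximity (R : realType) (m n g D : nat) (A : 'M[int]_(m, n)) h1 h0
    (b : 'cV[int]_m) (c : 'rV[int]_n) (xs : 'cV[R]_n) :
  (0 < g)%N ->
  (forall h, absz (rowdet A h) \in [:: 0; g; 2 * g]%N) ->
  (forall h, (absz (rowdet A h) <= D)%N) ->
  absz (rowdet A h1) = g -> rowdet A h0 != 0 ->
  inP A b xs -> (forall y, inP A b y -> lin c y <= lin c xs) ->
  (forall j, rowval A (h0 j) xs = (b (h0 j) 0)%:~R) ->
  (exists z, inPZ A b z) ->
  exists zs, [/\ inPZ A b zs,
    forall z, inPZ A b z -> (c *m z) 0 0 <= (c *m zs) 0 0 &
    cost A (xs - intvec R zs) (1 - D%:R^-1)].
Proof.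
move=> g0 Adet AD h1g h0n xsP xsO h0t feas.
have inPi z : inPZ A b z -> inP A b (intvec R z).
  by move=> zP i; rewrite -/(rowval A i _) rowval_intvec ler_int; apply: zP.
have zU z : inPZ A b z -> (c *m z) 0 0 <= Num.floor (lin c xs).
  by move=> zP; rewrite floor_ge_int -lin_intvec; apply/xsO/inPi.
have [z1 z1P z1M] := exists_min_nat (fun z : 'cV[int]_n => absz (Num.floor (lin c xs) - (c *m z) 0 0)%R) feas.
have z1O z : inPZ A b z -> (c *m z) 0 0 <= (c *m z1) 0 0.
  by move=> zP; have := z1M z zP; have := zU z zP; have := zU z1 z1P; lia.
pose Opt z := inPZ A b z /\ (c *m z) 0 0 = (c *m z1) 0 0.
have [|z [zP zO] zM] := @exists_min_nat _ Opt
  (fun z : 'cV[int]_n => absz (\sum_j (b (h0 j) 0 - (A *m z) (h0 j) 0))%R).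
  by exists z1.
exists z; split=> //; first by move=> z' /z1O; rewrite zO.
apply: (proximity_conformal g0 Adet AD h1g h0n) => [j|y yP].
  by rewrite rowvalB rowval_intvec h0t rpredB ?rpred_int.
have pE i : rowval A i (xs - intvec R z) = rowval A i xs - ((A *m z) i 0)%:~R.
  by rewrite rowvalB rowval_intvec.
(* By integrality, a value strictly below [b i 0 + 1] is at most [b i 0]; on the remaining rows [y]
   only lowers the value. *)
have zyP : inPZ A b (z + y).
  move=> i; rewrite mulmxDr mxE; have := yP i; rewrite pE rowval_intvec.
  case: ifPn => _.
    move=> /andP[_ lt]; have := xsP i; rewrite -/(rowval A i _) => le.
    have : ((A *m z) i 0 + (A *m y) i 0)%:~R < (b i 0 + 1)%:~R :> R.
      by rewrite !intrD; move: lt le; lra.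
    by rewrite ltr_int ltzD1.
  by rewrite lerz0 => y0; apply: le_trans (zP i); rewrite gerDl.
have ty i : rowval A i xs = (b i 0)%:~R -> 0 <= (A *m y) i 0.
  move=> t; have := yP i; rewrite pE t -intrB ler0z subr_ge0 zP => /andP[+ _].
  by rewrite rowval_intvec ler0z.
(* [xs] can move slightly against [y], so its optimality shows that [y] does not lower the
   objective. *)
have [|e e0 eP] := inP_step (d := - intvec R y) xsP.
  by move=> i /ty; rewrite rowvalN rowval_intvec oppr_le0 ler0z.
have cy : 0 <= (c *m y) 0 0.
  have := xsO _ eP; rewrite linD gerDl linZ pmulr_rle0 // linN oppr_le0 lin_intvec.
  by rewrite ler0z.
have zyO : Opt (z + y).
  have cE : (c *m (z + y)) 0 0 = (c *m z) 0 0 + (c *m y) 0 0 by rewrite mulmxDr mxE.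
  by split=> //; have := z1O _ zyP; rewrite -zO cE; move: cy; lia.
(* The slack cannot drop; as the rows [h0] are tight at [xs], every term is also nonnegative and
   thus 0. *)
have sum_y : \sum_j (A *m y) (h0 j) 0 <= 0.
  have := zM _ zyO.
  have -> : \sum_j (b (h0 j) 0 - (A *m (z + y)) (h0 j) 0) =
      \sum_j (b (h0 j) 0 - (A *m z) (h0 j) 0) - \sum_j (A *m y) (h0 j) 0.
    by rewrite -sumrB; apply: eq_bigr => j _; rewrite mulmxDr mxE opprD addrA.
  have : 0 <= \sum_j (b (h0 j) 0 - (A *m z) (h0 j) 0) - \sum_j (A *m y) (h0 j) 0.
    rewrite -sumrB; apply: sumr_ge0 => j _; have := zyP (h0 j).
    by rewrite mulmxDr mxE subr_ge0 lerBrDl.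
  by move: (\sum_j _) (\sum_j _) => s t; lia.
have y0 j : (A *m y) (h0 j) 0 = 0.
  have nn l : 0 <= (A *m y) (h0 l) 0 by apply: ty; apply: h0t.
  move: sum_y; rewrite (bigD1 j) //=.
  have : 0 <= \sum_(i < n | i != j) (A *m y) (h0 i) 0 by apply: sumr_ge0.
  by have := nn j; move: ((A *m y) (h0 j) 0) (\sum_(i < n | _) _) => s t; lia.
have /matrixP yy : intvec R y = 0.
  by apply: (basis_eq0 h0n) => j; rewrite rowval_intvec y0.
by apply/matrixP => i j; have /eqP := yy i j; rewrite !mxE intr_eq0 => /eqP.
Qed.

(** * Minors against [Delta], integral objectives and vertices *)

Lemma rank_kernel (R : realType) (m n : nat) (A : 'M[int]_(m, n)) (d : 'cV[R]_n) :
  \rank (mxR R A) = n -> (forall i, rowval A i d = 0) -> d = 0.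
Proof.
move=> rk d0; have f : row_full (mxR R A) by rewrite /row_full rk.
apply: (row_full_inj f); rewrite mulmx0; apply/matrixP => i j.
by rewrite ord1 [RHS]mxE; apply: d0.
Qed.

Lemma minor_le_Delta (m n j : nat) (A : 'M[int]_(m, n)) (f : 'I_j -> 'I_m)
    (g : 'I_j -> 'I_n) :
  injective g -> (absz (\det (mxsub f g A)) <= Delta j A)%N.
Proof.
move=> gi; have [/injectiveP fi|/injectivePn[x [y nxy fxy]]] := boolP (injectiveb f); last first.
  rewrite (_ : \det _ = 0) ?absz0 //; apply: (determinant_alternate nxy) => l.
  by rewrite !mxE fxy.
have fi' : injectiveb [ffun x => f x].
  by apply/injectiveP => x y; rewrite !ffunE; apply: fi.
have gi' : injectiveb [ffun x => g x].
  by apply/injectiveP => x y; rewrite !ffunE; apply: gi.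
apply: leq_trans (leq_bigmax_cond _ fi'); apply: leq_trans (leq_bigmax_cond _ gi').
by rewrite (_ : mxsub f g A = mxsub [ffun x => f x] [ffun x => g x] A) //;
  apply/matrixP => x y; rewrite !mxE !ffunE.
Qed.

Lemma rowdet_le_Delta (m n : nat) (A : 'M[int]_(m, n)) h :
  (absz (rowdet A h) <= Delta n A)%N.
Proof. exact: minor_le_Delta. Qed.

(** Expansion along the unit row leaves a single minor of order n - 1. *)
Lemma substdet_delta_le_Delta (m n : nat) (A : 'M[int]_(m, n)) h j l :
  (absz (substdet A h j (delta_mx 0%R l)) <= Delta n.-1 A)%N.
Proof.
case: n A h j l => [|n] A h j l; first by case: j.
rewrite /substdet (expand_det_row _ j) (bigD1 l) //= big1 => [|x xl]; last first.
  by rewrite !mxE !eqxx (negbTE xl) mul0r.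
rewrite addr0 !mxE !eqxx mul1r abszM absz_sign mul1n.
rewrite (_ : row' _ _ = mxsub (h \o lift j) (lift l) A).
  by apply: minor_le_Delta; apply: lift_inj.
by apply/matrixP => x y; rewrite !mxE eq_sym (negbTE (neq_lift _ _)).
Qed.

(** If all minors of order n - 1 vanished, Cramer's rule on a unit vector would make the determinant
    of [h] vanish. *)
Lemma Delta_pred_gt0 (m n : nat) (R : realType) (A : 'M[int]_(m, n)) h :
  (0 < n)%N -> rowdet A h != 0 -> (0 < Delta n.-1 A)%N.
Proof.
move=> n0 hn; rewrite lt0n; apply/eqP => D0; pose l := Ordinal n0.
have /eqP := @cramer R m n A h (delta_mx 0 l) (delta_mx l 0).
rewrite big1 => [|j _]; last first.
  have := substdet_delta_le_Delta A h j l; rewrite D0 leqn0 absz_eq0 => /eqP ->.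
  by rewrite mul0r.
by rewrite lin_delta mxE !eqxx mulr1 intr_eq0 (negbTE hn).
Qed.

Lemma clear_denominators (R : realType) (n : nat) (c : 'cV[rat]_n) :
  exists d (c' : 'rV[int]_n), 0 < d /\ forall x : 'cV[R]_n, lin c' x = d * cdot c x.
Proof.
pose d : int := \prod_j denq (c j 0).
have d0 : 0 < d by apply: prodr_gt0 => j _; apply: denq_gt0.
exists d%:~R, (\row_j (numq (c j 0) * \prod_(i | i != j) denq (c i 0))).
split=> [|x]; first by rewrite ltr0z.
rewrite /lin /cdot mxE mulr_sumr; apply: eq_bigr => j _; rewrite !mxE mulrA.
have dE : d = denq (c j 0) * \prod_(i | i != j) denq (c i 0) by rewrite /d (bigD1 j).
congr (_ * _); rewrite dE /ratr !intrM; field.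
by rewrite intr_eq0 denq_neq0.
Qed.

(** A direction on which all tight rows vanish could be followed both ways, so at a vertex it is 0
    and the tight rows contain a basis. *)
Lemma vertex_basis (R : realType) (m n : nat) (A : 'M[int]_(m, n)) b (x : 'cV[R]_n) :
  is_vertex (inP A b) x ->
  exists h, (forall j, rowval A (h j) x = (b (h j) 0)%:~R) /\ rowdet A h != 0.
Proof.
move=> [xP xV].
have [|h [ht hn]] := @basis_exists R m n A [pred i | rowval A i x == (b i 0)%:~R].
  move=> d dt.
  have [i /eqP/dt ->//|e1 e10 e1P] := @inP_step R m n A b x d xP.
  have [i /eqP/dt e|e2 e20 e2P] := @inP_step R m n A b x (- d) xP.
    by rewrite rowvalN e oppr0.
  have e12 : 0 < e1 + e2 by rewrite addr_gt0.
  have : x + e1 *: d = x + e2 *: - d.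
    apply: (xV _ _ (e2 / (e1 + e2))) => //.
      by rewrite divr_gt0 //= ltr_pdivrMr // mul1r ltrDr.
    apply/matrixP => i j; rewrite !mxE; field.
    by rewrite gt_eqF.
  move=> /addrI/eqP; rewrite scalerN -subr_eq0 opprK -scalerDl scaler_eq0.
  by rewrite gt_eqF //= => /eqP.
by exists h; split=> // j; apply/eqP/ht.
Qed.

(** * Existence of optimal basic solutions *)

Section LinearProgram.
Variables (R : realType) (m n : nat) (A : 'M[int]_(m, n)) (b : 'cV[int]_m) (c : 'rV[int]_n).
Hypothesis kA : forall d : 'cV[R]_n, (forall i, rowval A i d = 0) -> d = 0.
Hypothesis bounded : forall d : 'cV[R]_n, (forall i, rowval A i d <= 0) -> lin c d <= 0.
Implicit Types x y : 'cV[R]_n.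

(** While the tight rows contain no basis, move along a direction that keeps them tight, does not
    lower the objective and raises some row, until a new row becomes tight. *)
Lemma inP_tight_basis x : inP A b x ->
  exists y h, [/\ inP A b y, lin c x <= lin c y,
    (forall j, rowval A (h j) y = (b (h j) 0)%:~R) & rowdet A h != 0].
Proof.
move: {2}_.+1 (ltnSn #|[pred i | rowval A i x != (b i 0)%:~R]|) => N.
elim: N x => // N IH x leN xP.
have [[d0 [d0n d0t]]|nd] := pselect (exists d : 'cV[R]_n, d <> 0 /\
    forall i, rowval A i x == (b i 0)%:~R -> rowval A i d = 0); last first.
  have [d dt|h [ht hn]] := @basis_exists R m n A [pred i | rowval A i x == (b i 0)%:~R].
    by apply: contra_notP nd => dn; exists d.
  by exists x, h; split=> // j; apply/eqP/ht.
have [d [dt cd [i1 di1]]] : exists d : 'cV[R]_n, [/\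
    forall i, rowval A i x == (b i 0)%:~R -> rowval A i d = 0, 0 <= lin c d &
    exists i, 0 < rowval A i d].
  (* If no row grows along [d], boundedness makes the objective constant on it, and [- d] raises
     some row because the kernel is trivial. *)
  have pos (d : 'cV[R]_n) : d <> 0 -> 0 <= lin c d ->
      (exists i, 0 < rowval A i d) \/ lin c d = 0 /\ exists i, 0 < rowval A i (- d).
    move=> dn cd; apply: contrapT => /not_orP[/forallNP n1 n2].
    have le i : rowval A i d <= 0 by rewrite leNgt; apply/negP/n1.
    apply: n2; split; first by apply/eqP; rewrite eq_le cd bounded.
    apply: contrapT => /forallNP n3; apply: dn; apply: kA => i; apply/eqP.
    by rewrite eq_le le -oppr_le0 -rowvalN leNgt; apply/negP/n3.
  have oppt (d : 'cV[R]_n) : (forall i, rowval A i x == (b i 0)%:~R -> rowval A i d = 0) ->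
      forall i, rowval A i x == (b i 0)%:~R -> rowval A i (- d) = 0.
    by move=> H i /H e; rewrite rowvalN e oppr0.
  have fin (d : 'cV[R]_n) : d <> 0 -> 0 <= lin c d ->
      (forall i, rowval A i x == (b i 0)%:~R -> rowval A i d = 0) ->
      exists d : 'cV[R]_n, [/\
      forall i, rowval A i x == (b i 0)%:~R -> rowval A i d = 0, 0 <= lin c d &
      exists i, 0 < rowval A i d].
    move=> dn cd dt; have [?|[cd0 ?]] := pos d dn cd; first by exists d.
    by exists (- d); split=> //; [exact: oppt|rewrite linN cd0 oppr0].
  have [cd|cd] := leP 0 (lin c d0); first exact: fin cd d0t.
  apply: (fin (- d0)) => //; last exact: oppt.
    by move=> /eqP; rewrite oppr_eq0 => /eqP.
  by rewrite linN oppr_ge0 ltW.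
pose F i := ((b i 0)%:~R - rowval A i x) / rowval A i d.
case: (arg_minP F (di1 : (fun i => 0 < rowval A i d) i1)) => i2 di2 mi2.
have sl i : 0 <= (b i 0)%:~R - rowval A i x by rewrite subr_ge0; apply: xP.
have t0 : 0 <= F i2 by rewrite divr_ge0 // ltW.
have vE i : rowval A i (x + F i2 *: d) = rowval A i x + F i2 * rowval A i d.
  by rewrite rowvalD rowvalZ.
have [||y [h [yP cy yt hn]]] := IH (x + F i2 *: d).
- rewrite ltnS in leN; apply: leq_trans leN; apply: proper_card; apply/properP; split.
    apply/fintype.subsetP => i; rewrite !inE vE; apply: contra => t.
    by rewrite dt // mulr0 addr0.
  exists i2; rewrite !inE.
    by apply/negP => /dt e; rewrite e ltxx in di2.
  by rewrite negbK vE /F divfK ?(gt_eqF di2) // addrC subrK.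
- move=> i; rewrite -/(rowval A i _) vE -lerBrDl.
  have [di|di] := ltP 0 (rowval A i d); last by apply: le_trans (sl i); apply: mulr_ge0_le0.
  by rewrite -ler_pdivlMr //; apply: mi2.
exists y, h; split=> //; apply: le_trans cy; rewrite linD linZ lerDl.
by rewrite mulr_ge0.
Qed.

(** There are finitely many bases, each with at most one point tight on it; the best such point
    dominates all others by [inP_tight_basis]. *)
Lemma lp_optimal_basis : (exists x : 'cV[R]_n, inP A b x) ->
  exists (xs : 'cV[R]_n) h, [/\ inP A b xs, forall y, inP A b y -> lin c y <= lin c xs,
    (forall j, rowval A (h j) xs = (b (h j) 0)%:~R) & rowdet A h != 0].
Proof.
move=> [x0 x0P].
pose Q (h : 'I_n -> 'I_m) (y : 'cV[R]_n) := [/\ inP A b y,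
  (forall j, rowval A (h j) y = (b (h j) 0)%:~R) & rowdet A h != 0].
(* The default 0 is harmless: the maximum is taken over selections that do have a basic point. *)
pose Y (h : {ffun 'I_n -> 'I_m}) := xget 0 (Q h : set 'cV[R]_n).
have QY h y : Q h y -> Y [ffun j => h j] = y.
  move=> [yP yt hn].
  have fE : [ffun j => h j] = h :> ('I_n -> 'I_m) by apply: funext => j; rewrite ffunE.
  have [YP Yt _] : Q [ffun j => h j] (Y [ffun j => h j]).
    by apply: (@xgetPex _ _ (Q _ : set 'cV[R]_n)); exists y; rewrite fE.
  apply/eqP; rewrite -subr_eq0; apply/eqP; apply: (basis_eq0 hn) => j.
  by have := Yt j; rewrite fE rowvalB yt => ->; rewrite subrr.
have [y1 [h1 [y1P _ y1t h1n]]] := inP_tight_basis x0P.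
have Qf h y : Q h y -> Q [ffun j => h j] y.
  by have -> : [ffun j => h j] = h :> ('I_n -> 'I_m) by apply: funext => j; rewrite ffunE.
have Q1 : `[< exists y, Q [ffun j => h1 j] y >] by apply/asboolP; exists y1; apply: Qf.
case: (@arg_maxP _ _ _ [ffun j => h1 j] (fun h : {ffun 'I_n -> 'I_m} => `[< exists y, Q h y >])
  (fun h => lin c (Y h)) Q1) => hs /asboolP Qs ms.
have [YP Yt hsn] : Q hs (Y hs) by apply: (@xgetPex _ _ (Q _ : set 'cV[R]_n)).
exists (Y hs), hs; split=> // y /inP_tight_basis[y2 [h2 [y2P cy y2t h2n]]].
apply: le_trans cy _; have Q2 : Q h2 y2 by [].
rewrite -(QY _ _ Q2); apply: ms; apply/asboolP; exists y2; exact: Qf.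
Qed.

End LinearProgram.

(** * Integral recession directions and flatness *)

Lemma integral_direction (R : realType) (m n : nat) (A : 'M[int]_(m, n)) i0
    (u : 'cV[R]_n) :
  (forall d : 'cV[R]_n, (forall i, rowval A i d = 0) -> d = 0) ->
  (forall i, 0 <= rowval A i u) -> 0 < rowval A i0 u ->
  exists2 z : 'cV[int]_n, forall i, 0 <= (A *m z) i 0 & 0 < (A *m z) i0 0.
Proof.
move=> kA u0 ui0.
have [||//||h [j0 [y [_ hj hn hz [yi0 y0 _]]]]] := @ray_exists R m n A predT u i0.
- by move=> d H; apply: kA => i; apply: H.
- by move=> i _; apply: u0.
- by [].
(* By Cramer's rule these determinants are the coordinates of [y] up to a common factor, which the
   sign makes positive. *)
pose z : 'cV[int]_n := \col_l (Num.sg (rowdet A h) * substdet A h j0 (delta_mx 0 l)).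
have zE : intvec R z = (`|(rowdet A h)%:~R| / rowval A i0 y) *: y.
  apply/matrixP => l j; rewrite ord1 !mxE -(lin_delta l y) intrM.
  have := cramer_ray (delta_mx 0 l) hz; rewrite hj => e.
  rewrite -intr_norm normrEsg intrM mulrAC -[X in X / _]mulrA e.
  by rewrite mulrA mulfK ?gt_eqF.
have k0 : 0 < `|(rowdet A h)%:~R| / rowval A i0 y by rewrite divr_gt0 // normr_gt0 intr_eq0.
exists z => [i|].
  rewrite -(ler0z R) -rowval_intvec zE rowvalZ mulr_ge0 ?y0 //; exact: ltW.
by rewrite -(ltr0z R) -rowval_intvec zE rowvalZ mulr_gt0.
Qed.

Lemma flatness (R : realType) (m n g : nat) (A : 'M[int]_(m, n)) h1 (b : 'cV[int]_m) :
  (0 < g)%N ->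
  (forall h, absz (rowdet A h) \in [:: 0; g; 2 * g]%N) ->
  absz (rowdet A h1) = g ->
  (forall d : 'cV[R]_n, (forall i, rowval A i d = 0) -> d = 0) ->
  (forall z : 'cV[int]_n, ~ inPZ A b z) ->
  exists i, (width (@inP R _ _ A b) (row i (mxR R A)) <= ((Delta n A)%:R - 2)%:E)%E.
Proof.
move=> g0 Adet h1g kA noz.
(* Once all rows are relaxed to a nonnegative right-hand side, 0 is feasible. *)
pose bj (j : nat) : 'cV[int]_m := \col_i if (i < j)%N then Num.max (b i 0) 0 else b i 0.
have feasm : exists j, `[< exists z, inPZ A (bj j) z >].
  exists m; apply/asboolP; exists 0 => i.
  by rewrite mulmx0 !mxE ltn_ord le_max lexx orbT.
case: (ex_minnP feasm) => -[|j] /asboolP feas jmin.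
  case: feas => z zP; case: (noz z) => i; have := zP i; by rewrite !mxE ltn0.
have infeas z : ~ inPZ A (bj j) z.
  by move=> zP; have : (j < j)%N; [apply: jmin; apply/asboolP; exists z | rewrite ltnn].
have jm : (j < m)%N.
  rewrite ltnNge; apply/negP => mj; case: feas => z zP; apply: (infeas z) => i.
  by have := zP i; rewrite !mxE (leq_trans (ltn_ord i) mj) ltnS ltnW // (leq_trans (ltn_ord i) mj).
pose i := Ordinal jm.
have bji : bj j i 0 = b i 0 by rewrite mxE ltnn.
have bjS l : l != i -> bj j.+1 l 0 = bj j l 0.
  by move=> li; rewrite !mxE ltnS leq_eqVlt -[(l == j :> nat)]/(l == i) (negbTE li).
have b_le l : b l 0 <= bj j.+1 l 0 by rewrite mxE; case: ifP => // _; rewrite le_max lexx.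
have zi z : inPZ A (bj j.+1) z -> b i 0 + 1 <= (A *m z) i 0.
  move=> zP; rewrite lezD1 ltNge; apply/negP => le; apply: (infeas z) => l.
  by have [->|/bjS <-] := eqVneq l i; rewrite ?bji.
pose c := - row i A.
have cE (x : 'cV[R]_n) : lin c x = - rowval A i x.
  by rewrite rowvalE /lin /c map_mxN mulNmx mxE.
have [d||xs [h0 [xsP xsO h0t h0n]]] := @lp_optimal_basis R m n A (bj j.+1) c kA.
(* Otherwise an integral direction lowering row [i] and raising no row would carry an integer point
   of [bj j.+1] into the infeasible system [bj j]. *)
- move=> dA; rewrite cE oppr_le0 leNgt; apply/negP => di.
  have [||v v0 vi] := @integral_direction R m n A i (- d) kA.
  + by move=> l; rewrite rowvalN oppr_ge0.
  + by rewrite rowvalN oppr_gt0.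
  have [z zP] := feas.
  pose N : int := absz ((A *m z) i 0 - b i 0)%R.
  have AE l : (A *m (z - N *: v)) l 0 = (A *m z) l 0 - N * (A *m v) l 0.
    by rewrite mulmxBr -scalemxAr [LHS]mxE [X in _ + X]mxE [X in - X]mxE.
  apply: (infeas (z - N *: v)) => l; rewrite AE.
  have [->|/bjS <-] := eqVneq l i; last first.
    by apply: le_trans (zP l); rewrite gerBl mulr_ge0.
  rewrite bji; have : N <= N * (A *m v) i 0 by rewrite ler_peMr // -gtz0_ge1.
  have : (A *m z) i 0 - b i 0 <= N by rewrite /N abszE ler_norm.
  by move: (N * _) ((A *m z) i 0) => s t; lia.
- have [z zP] := feas; exists (intvec R z) => l; rewrite -/(rowval A l _) rowval_intvec.
  by rewrite ler_int; apply: zP.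
have [zs [zsP _ zsc]] := integer_proximity g0 Adet (@rowdet_le_Delta _ _ A) h1g h0n xsP xsO h0t feas.
have D0 : 0 < (Delta n A)%:R :> R.
  by rewrite ltr0n (leq_trans _ (rowdet_le_Delta A h1)) // h1g.
exists i.
have valE (x : 'cV[R]_n) : (row i (mxR R A) *m x) 0 0 = rowval A i x.
  by rewrite /rowval -row_mul mxE.
have inPj (x : 'cV[R]_n) : inP A b x -> inP A (bj j.+1) x.
  by move=> xP l; apply: le_trans (xP l) _; rewrite ler_int.
(* On the original polyhedron row [i] is at most [b i 0], and at least its minimum over the larger
   relaxed one, attained at [xs]. *)
apply: (@le_trans _ _ ((b i 0)%:~R%:E - (rowval A i xs)%:E)%E).
  apply: leeB.
    by apply: ge_ereal_sup => _ [x xP <-]; rewrite valE lee_fin; apply: xP.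
  apply: le_ereal_inf_tmp => _ [x xP <-]; rewrite valE lee_fin.
  by have := xsO x (inPj x xP); rewrite !cE lerN2.
rewrite -EFinB lee_fin.
have B h l : (absz (substdet A h l (row i A)) <= Delta n A)%N.
  by rewrite substdet_row rowdet_le_Delta.
have := zsc _ _ B; rewrite -rowvalE.
rewrite rowvalB rowval_intvec mulrBr mulr1 divff ?(gt_eqF D0) // => H.
(* In row [i], [zs] is at least 1 above [b i 0] and at most Delta_n - 1 above [xs]. *)
have : (b i 0 + 1)%:~R <= ((A *m zs) i 0)%:~R :> R by rewrite ler_int; apply: zi.
rewrite intrD; move: H; rewrite ler_norml => /andP[]; lra.
Qed.

(** * Normalisation of the minors and conclusion *)

(** Take [g = k] if some minor has size [k]; otherwise all nonzero ones have size [2 * k], full rank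
    provides one, and [g = 2 * k] is attained. *)
Lemma exists_bimodular_scale (R : realType) (m n k : nat) (A : 'M[int]_(m, n)) :
  \rank (mxR R A) = n -> (1 <= k)%N ->
  (forall (f : {ffun 'I_n -> 'I_m}) (g : {ffun 'I_n -> 'I_n}),
      injectiveb f -> injectiveb g ->
      \det (mxsub f g A) \in [:: 0; k%:Z; - k%:Z; (2 * k)%:Z; - (2 * k)%:Z]) ->
  exists g h1, [/\ (0 < g)%N,
    forall h, absz (rowdet A h) \in [:: 0; g; 2 * g]%N & absz (rowdet A h1) = g].
Proof.
move=> rk k0 Ak.
have Adet h : absz (rowdet A h) \in [:: 0; k; 2 * k]%N.
  have [->|hn] := eqVneq (rowdet A h) 0; first by rewrite !inE.
  have := Ak [ffun x => h x] [ffun x => x].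
  have -> : mxsub [ffun x => h x] [ffun x => x] A = rowsub h A.
    by apply/matrixP => x y; rewrite !mxE !ffunE.
  have -> : injectiveb [ffun x => h x].
    by apply/injectiveP => x y; rewrite !ffunE => /(rowdet_inj hn).
  have -> : injectiveb [ffun x : 'I_n => x].
    by apply/injectiveP => x y; rewrite !ffunE.
  move=> /(_ isT isT); rewrite -/(rowdet A h) !inE.
  by move=> /or4P[| | |/orP[|]] /eqP ->; rewrite ?abszN ?eqxx ?orbT.
have [[h1 h1k]|/forallNP nk] := pselect (exists h, absz (rowdet A h) = k).
  by exists k, h1.
have [d d0|h1 [_ h1n]] := @basis_exists R m n A predT.
  by apply: (rank_kernel rk) => i; apply: d0.
have A2 h : absz (rowdet A h) = 0%N \/ absz (rowdet A h) = (2 * k)%N.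
  have := Adet h; rewrite !inE => /or3P[] /eqP; [by left| |by right].
  by move=> /nk.
exists (2 * k)%N, h1; split=> [|h|].
- by rewrite muln_gt0.
- by case: (A2 h) => ->; rewrite !inE eqxx ?orbT.
- by case: (A2 h1) => // /eqP; rewrite absz_eq0 (negbTE h1n).
Qed.

Theorem theorem6 (R : realType) (m n : nat) (A : 'M[int]_(m, n)) (k : nat) :
  (2 <= n)%N ->
  \rank (mxR R A) = n ->
  (1 <= k)%N ->
  (forall (f : {ffun 'I_n -> 'I_m}) (g : {ffun 'I_n -> 'I_n}),
      injectiveb f -> injectiveb g ->
      \det (mxsub f g A) \in [:: 0; k%:Z; - k%:Z; (2 * k)%:Z; - (2 * k)%:Z]) ->
  (* (1) proximity *)
  (forall (b : 'cV[int]_m) (c : 'cV[rat]_n) (xs : 'cV[R]_n),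
      is_vertex (@inP R _ _ A b) xs ->
      (forall y, @inP R _ _ A b y ->
         cdot c y <= cdot c xs) ->
      (exists z : 'cV[int]_n, inPZ A b z) ->
      exists zs : 'cV[int]_n,
        [/\ inPZ A b zs,
            (forall z : 'cV[int]_n, inPZ A b z ->
               cdot c (intvec R z) <= cdot c (intvec R zs)),
            norm_inf (xs - intvec R zs)
              <= (maxn (Delta n.-1 A) (Delta n A))%:R - 1
          & norm_inf (xs - intvec R zs) < (Delta n.-1 A)%:R]) /\
  (* (2) flatness *)
  (forall b : 'cV[int]_m,
      full_dim (@inP R _ _ A b) ->
      (forall z : 'cV[int]_n, ~ inPZ A b z) ->
      (forall i : 'I_m, row_facet R A b i) ->
      exists i : 'I_m,
        (width (@inP R _ _ A b) (row i (mxR R A)) <= ((Delta n A)%:R - 2)%:E)%E).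
Proof.
move=> n2 rk k0 Ak.
have [g [h1 [g0 Adet h1g]]] := exists_bimodular_scale rk k0 Ak.
split=> [b c xs xsV xsO feas|b _ noz _]; last first.
  by apply: (flatness g0 Adet h1g) => // d; apply: rank_kernel.
have h1n : rowdet A h1 != 0 by rewrite -absz_gt0 h1g.
have [h0 [h0t h0n]] := vertex_basis xsV.
have [d [c' [d0 cE]]] := clear_denominators R c.
have [y yP|zs [zsP zsO zsc]] := integer_proximity (c := c') g0 Adet
  (@rowdet_le_Delta _ _ A) h1g h0n (proj1 xsV) _ h0t feas.
  by rewrite !cE ler_pM2l // xsO.
set D := Delta n A; set D' := Delta n.-1 A.
have D0 : 0 < D%:R :> R.
  by rewrite ltr0n (leq_trans _ (rowdet_le_Delta A h1)) // h1g.
have D'0 : 0 < D'%:R :> R by rewrite ltr0n (@Delta_pred_gt0 m n R A h1) // ltnW.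
have Di0 : 0 < D%:R^-1 :> R by rewrite invr_gt0.
have Di1 : D%:R^-1 <= 1 :> R by rewrite invf_le1 // ler1n -(ltr0n R).
(* Coordinates are the forms given by unit vectors, whose Cramer numerators are minors of order n -
   1. *)
have nrm : norm_inf (xs - intvec R zs) <= D'%:R * (1 - D%:R^-1).
  apply: bigmax_le => [|l _]; first by rewrite mulr_ge0 ?subr_ge0 // ltW.
  rewrite -lin_delta; apply: zsc => h j; exact: substdet_delta_le_Delta.
exists zs; split=> //.
- move=> z zP; rewrite -(ler_pM2l d0) -!cE !lin_intvec ler_int; exact: zsO.
(* If [D'] is at most [D], replace the factor [D'] by [D]; otherwise the subtracted quotient of [D']
   by [D] is at least 1. *)
- apply: le_trans nrm _; case: (leqP D' D) => le.
    have -> : D%:R - 1 = D%:R * (1 - D%:R^-1) :> R.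
      by rewrite mulrBr mulr1 divff ?gt_eqF.
    by rewrite ler_wpM2r ?subr_ge0 // ler_nat.
  by rewrite mulrBr mulr1 lerD2l lerN2 ler_pdivlMr // mul1r ler_nat ltnW.
- apply: le_lt_trans nrm _; by rewrite gtr_pMr // ltrBlDr ltrDl.
Qed.
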